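(* Let $I\subseteq\mathbb{R}\langle x,x^*\rangle$ be the left ideal generated by a nonzero polynomial $p$. (1) Suppose $p$ is homogeneous. Then $I$ is real if and only if $p$ is not of the form $p=(s+q)f$, where $s$ is a nonconstant sum of squares, $q^*=-q$, and $f\in\mathbb{R}\langle x,x^*\rangle$. (2) For $p$ not necessarily homogeneous: if $p=(s+q)f$ with $s$ a nonconstant sum of squares, $q^*=-q$, and $f\in\mathbb{R}\langle x,x^*\rangle$, then $I$ is not real. (3) Suppose $p$ is nonconstant and $p=a+b^*$, where $a$ and $b$ are analytic polynomials. Then $I$ is not real if and only if $p=a-a^*+c$ (or equivalently, $p=-b+b^*+c$) for some nonzero constant $c\in\mathbb{R}$.
   Context: $\mathbb{R}\langle x,x^*\rangle$ is the free unital associative $\mathbb{R}$-algebra on the $2g$ noncommuting letters $x_1,\dots,x_g,x_1^*,\dots,x_g^*$, with the $\mathbb{R}$-linear involution $*$ that exchanges $x_i$ and $x_i^*$ and reverses products. A polynomial is homogeneous if all its words have the same length. A polynomial is analytic if it contains none of the letters $x_i^*$. A sum of squares is a finite sum $\sum_i a_i^*a_i$ with $a_i\in\mathbb{R}\langle x,x^*\rangle$. For a left ideal $I$, $I^*=\{a^*: a\in I\}$; $I$ is real if whenever $a_1,\dots,a_r\in\mathbb{R}\langle x,x^*\rangle$ satisfy $\sum_{i=1}^r a_i^*a_i\in I+I^*$, then $a_1,\dots,a_r\in I$. *)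

(* Defs.v *)
From HB Require Import structures.
From mathcomp Require Import all_boot all_order all_algebra.
From mathcomp Require Import finmap.
From mathcomp Require Import classical_sets reals.
From mathcomp Require Import monalg.

Set Implicit Arguments.
Unset Strict Implicit.
Unset Printing Implicit Defensive.

Import GRing.Theory.
Local Open Scope ring_scope.
Local Open Scope classical_set_scope.

(* (i, false) stands for the letter x_i and (i, true) for x_i^*. *)
Definition letter (g : nat) : choiceType := ('I_g * bool)%type.

(* R<x, x^*>: the monoid algebra of the free monoid on the letters. *)
Notation ncpoly R g := {malg R[{fmonom (letter g)}]}.

Definition star_letter (g : nat) (l : letter g) : letter g := (l.1, ~~ l.2).

Definition star_word (g : nat) (w : {fmonom (letter g)}) :
    {fmonom (letter g)} :=
  FMonom (rev (map (@star_letter g) (fmonom_val w))).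

Definition star (R : realType) (g : nat) (a : ncpoly R g) : ncpoly R g :=
  \sum_(w <- msupp a) << a@_w *g star_word w >>.

Definition constant_poly (R : realType) (g : nat) (a : ncpoly R g) : Prop :=
  exists c : R, a = c%:MP.

Definition homogeneous (R : realType) (g : nat) (a : ncpoly R g) : Prop :=
  exists d : nat, forall w, w \in msupp a -> fdeg w = d.

Definition analytic (R : realType) (g : nat) (a : ncpoly R g) : Prop :=
  forall w, w \in msupp a -> forall i : 'I_g, (i, true) \notin fmonom_val w.

Definition sum_of_squares (R : realType) (g : nat) (s : ncpoly R g) : Prop :=
  exists (r : nat) (a : 'I_r -> ncpoly R g), s = \sum_(i < r) star (a i) * a i.

Definition left_ideal (R : realType) (g : nat) (I : set (ncpoly R g)) : Prop :=
  [/\ I 0,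
      forall a b, I a -> I b -> I (a + b)
    & forall a b, I b -> I (a * b)].

Definition lideal_gen (R : realType) (g : nat) (p : ncpoly R g) :
    set (ncpoly R g) :=
  smallest (@left_ideal R g) [set p].

Definition star_ideal (R : realType) (g : nat) (I : set (ncpoly R g)) :
    set (ncpoly R g) :=
  [set star a | a in I].

Definition real_ideal (R : realType) (g : nat) (I : set (ncpoly R g)) : Prop :=
  forall (r : nat) (a : 'I_r -> ncpoly R g),
    [set u + v | u in I & v in star_ideal I] (\sum_(i < r) star (a i) * a i) ->
    forall i, I (a i).

Section StarTheory.
Context {R : realType} {g : nat}.
Implicit Types (a b : ncpoly R g) (w : {fmonom (letter g)}).

Lemma star_wordK : involutive (@star_word g).
Proof.
case=> s; rewrite /star_word /= map_rev revK -map_comp map_id_in // => -[i b] _.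
by rewrite /star_letter /= negbK.
Qed.

Lemma star_word1 : star_word (mone : {fmonom (letter g)}) = mone.
Proof. by rewrite /mone /= /fmone fmE. Qed.

Lemma star_wordM (v w : {fmonom (letter g)}) :
  star_word (mmul v w) = mmul (star_word w) (star_word v).
Proof. by rewrite /mmul /= /fmmul !fmE /star_word /= map_cat rev_cat. Qed.

Lemma mcoeff_star a w : (star a)@_w = a@_(star_word w).
Proof.
rewrite [in RHS](monalgE a) /star !raddf_sum /=; apply: eq_bigr => v _.
by rewrite !mcoeffU (inv_eq star_wordK).
Qed.

Lemma star_is_zmod_morphism : zmod_morphism (@star R g).
Proof. by move=> a b; apply/malgP => w; rewrite mcoeffB !mcoeff_star mcoeffB. Qed.

HB.instance Definition _ :=
  GRing.isZmodMorphism.Build (ncpoly R g) (ncpoly R g) (@star R g) star_is_zmod_morphism.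

Lemma starK : involutive (@star R g).
Proof. by move=> a; apply/malgP => w; rewrite !mcoeff_star star_wordK. Qed.

Lemma starZ (c : R) a : star (c *: a) = c *: star a.
Proof. by apply/malgP => w; rewrite mcoeffZ !mcoeff_star mcoeffZ. Qed.

Lemma starU (c : R) w :
  star (<< c *g w >> : ncpoly R g) = << c *g star_word w >>.
Proof.
by apply/malgP => v; rewrite mcoeff_star !mcoeffU (inv_eq star_wordK).
Qed.

Lemma starC (c : R) : star (c%:MP : ncpoly R g) = c%:MP.
Proof. by rewrite starU star_word1. Qed.

Lemma starM a b : star (a * b) = star b * star a.
Proof.
rewrite malgME raddf_sum [in RHS](monalgE a) [in RHS](monalgE b).
rewrite !(raddf_sum (@star R g)) /= mulr_sumr; apply: eq_bigr => v _.
rewrite raddf_sum mulr_suml; apply: eq_bigr => w _ /=.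
by rewrite !starU star_wordM malgM_def fgmulUU mulrC.
Qed.

Lemma star_letterE (i : 'I_g) (b : bool) :
  star (<< @fmu (letter g) (i, b) >> : ncpoly R g)
  = << @fmu (letter g) (i, ~~ b) >>.
Proof. by rewrite starU /fmu !fmE. Qed.

Lemma left_ideal_gen (p : ncpoly R g) : left_ideal (lideal_gen p).
Proof.
split=> [J [[J0 _ _] _] //|a b Ia Ib J JP|a b Ib J JP].
- by case: (JP) => -[_ JD _] _; apply: JD; [exact: Ia|exact: Ib].
- by case: (JP) => -[_ _ JM] _; apply: JM; exact: Ib.
Qed.

Lemma lideal_genP (p a : ncpoly R g) :
  lideal_gen p a <-> exists r : ncpoly R g, a = r * p.
Proof.
split=> [Ia|[r ->]]; last by move=> J [[_ _ JM] Jp]; apply: JM; exact: Jp.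
apply: (Ia [set b | exists r, b = r * p]); split; last first.
  by move=> _ ->; exists 1; rewrite mul1r.
split=> [|_ _ [r ->] [t ->]|b _ [r ->]].
- by exists 0; rewrite mul0r.
- by exists (r + t); rewrite mulrDl.
- by exists (b * r); rewrite mulrA.
Qed.

End StarTheory.

(* Main.v *)
(* If p = (s + q) f then f^* p + p^* f = 2 f^* s f, so if I were real it would
   contain every a_i f, where s is the sum of the a_i^* a_i; cancelling f,
   a_i is a left multiple of s + q, whose degree is at least deg s = 2 max deg a_j.

   Conversely, let sum a_i^* a_i = h p + p^* h^* with a_i of degree at most D,
   and look at the top components. If sum a_i^* a_i = x y + y^* x^* with
   everything homogeneous and deg y <= deg a_i, then each a_i is a left multiple
   of y: pick a word w of y, subtract multiples of y from the a_i to kill all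
   words ending in w, and compare the coefficients of the words ending in w; they
   force x = y^* k with k^* = - k, so the new sum of squares vanishes. With
   y = p this lowers D. If D < deg p, then y = h^* gives a_i = b_i h^*, and the same
   coefficient comparison gives p = (sum b_i^* b_i + q) f with f proportional
   to h^*. For p = a + b^* no word of p mixes starred and unstarred letters,
   whereas (s + q) f contains words w^* w v; the only remaining possibility is
   that the leading terms of h p and p^* h^* cancel, which happens irreducibly
   only for constant h and forces p + p^* to be constant. *)

Require Import Defs.
From mathcomp Require Import all_boot all_order all_algebra.
From mathcomp Require Import finmap boolp classical_sets reals monalg zify ring lra.

Set Implicit Arguments.
Unset Strict Implicit.
Unset Printing Implicit Defensive.

Import GRing.Theory Num.Theory.
Local Open Scope ring_scope.


(** * Words, and an abstract view of the free algebra with involution *)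

Definition sword (g : nat) (s : seq (letter g)) : seq (letter g) :=
  rev (map (@star_letter g) s).

(* The polynomials with their coefficient functions, abstracted so that
   unification never unfolds the product of the monoid algebra. *)
Record wordAlg (R : realType) (g : nat) := WordAlg {
  wa_carrier :> lalgType R;
  cf : wa_carrier -> seq (letter g) -> R;
  adj : wa_carrier -> wa_carrier;
  hpart : nat -> wa_carrier -> wa_carrier;
  rquot : seq (letter g) -> wa_carrier -> wa_carrier;
  cf_inj : forall a b, (forall s, cf a s = cf b s) -> a = b;
  cf_bounded : forall a, exists n, forall s, cf a s != 0 -> (size s < n)%N;
  cfD : forall a b s, cf (a + b) s = cf a s + cf b s;
  cfZ : forall c a s, cf (c *: a) s = c * cf a s;
  cf1 : forall s, cf 1 s = (s == [::])%:R;
  cfM : forall a b s,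
    cf (a * b) s = \sum_(i < (size s).+1) cf a (take i s) * cf b (drop i s);
  cf_adj : forall a s, cf (adj a) s = cf a (sword s);
  hpartE : forall n a s, cf (hpart n a) s = if size s == n then cf a s else 0;
  rquotE : forall v a s, cf (rquot v a) s = cf a (s ++ v)
}.

Section Words.
Context {g : nat}.
Implicit Types s t u v : seq (letter g).

Lemma swordK : involutive (@sword g).
Proof. by move=> s; have /(congr1 (@fmonom_val _)) := star_wordK (FMonom s). Qed.

Lemma sword_cat u v : sword (u ++ v) = sword v ++ sword u.
Proof. by rewrite /sword map_cat rev_cat. Qed.

Lemma size_sword s : size (sword s) = size s.
Proof. by rewrite size_rev size_map. Qed.

End Words.

Section WordAlg.
Context {R : realType} {g : nat} {A : wordAlg R g}.
Implicit Types (a b p q x y : A) (s t u v : seq (letter g)).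

Definition deg_lt n a : Prop := forall s, cf a s != 0 -> (size s < n)%N.

Definition homog n a : Prop := forall s, cf a s != 0 -> size s = n.

(** Homogeneous form of (s + q) f: the polynomials squared share one degree m > 0 and are not all
    zero, so s is nonconstant; q has degree 2m, and f is arbitrary. *)
Definition sos_skew_multiple p : Prop :=
  exists (m r : nat) (c : 'I_r -> A) (q f : A),
    [/\ (0 < m)%N, forall i, homog m (c i), exists i, c i != 0,
        homog (m + m) q & adj q = - q] /\
    p = (\sum_i adj (c i) * c i + q) * f.

(** * Coefficients of sums, adjoints and products *)

Lemma cf0 s : cf (0 : A) s = 0.
Proof. by rewrite -(scale0r 0) cfZ mul0r. Qed.

Lemma cfN a s : cf (- a) s = - cf a s.
Proof. by rewrite -scaleN1r cfZ mulN1r. Qed.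

Lemma cfB a b s : cf (a - b) s = cf a s - cf b s.
Proof. by rewrite cfD cfN. Qed.

Lemma cf_sum (r : nat) (F : 'I_r -> A) s :
  cf (\sum_i F i) s = \sum_i cf (F i) s.
Proof.
by apply: (big_morph (fun a => cf a s)) => [a b|]; rewrite ?cfD ?cf0.
Qed.

Lemma adjK : involutive (@adj R g A).
Proof. by move=> a; apply: cf_inj => s; rewrite !cf_adj swordK. Qed.

Lemma adjD a b : adj (a + b) = adj a + adj b.
Proof. by apply: cf_inj => s; rewrite !(cf_adj, cfD). Qed.

Lemma adjB a b : adj (a - b) = adj a - adj b.
Proof. by apply: cf_inj => s; rewrite !(cf_adj, cfB). Qed.

Lemma adj0 : adj (0 : A) = 0.
Proof. by apply: cf_inj => s; rewrite cf_adj !cf0. Qed.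

Lemma adj1 : adj (1 : A) = 1.
Proof.
by apply: cf_inj => s; rewrite cf_adj !cf1 -!size_eq0 size_sword.
Qed.

Lemma adjZ (c : R) a : adj (c *: a) = c *: adj a.
Proof. by apply: cf_inj => s; rewrite !(cf_adj, cfZ). Qed.

Lemma adjM a b : adj (a * b) = adj b * adj a.
Proof.
apply: cf_inj => s; rewrite cf_adj !cfM size_sword (reindex_inj rev_ord_inj).
apply: eq_bigr => i _ /=; rewrite !cf_adj mulrC subSS /sword.
by rewrite !(take_rev, drop_rev) -!map_take -!map_drop size_map subKn // -ltnS.
Qed.

Lemma cfM_cat a b u v :
  (forall i, (i <= size (u ++ v))%N -> i != size u ->
     cf a (take i (u ++ v)) * cf b (drop i (u ++ v)) = 0) ->
  cf (a * b) (u ++ v) = cf a u * cf b v.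
Proof.
move=> ab0; have uP : (size u < (size (u ++ v)).+1)%N.
  by rewrite size_cat ltnS leq_addr.
rewrite cfM (bigD1 (Ordinal uP)) //= take_size_cat // drop_size_cat //.
by rewrite big1 ?addr0 // => -[i ile] iu; apply: ab0.
Qed.

Lemma cfM_homogl m a b u v :
  homog m a -> size u = m -> cf (a * b) (u ++ v) = cf a u * cf b v.
Proof.
move=> am um; apply: cfM_cat => i ile; apply: contraNeq; rewrite mulf_eq0.
by rewrite negb_or => /andP[/am]; rewrite size_takel // um => /eqP.
Qed.

Lemma cfM_homogr n a b u v :
  homog n b -> size v = n -> cf (a * b) (u ++ v) = cf a u * cf b v.
Proof.
move=> bn vn; apply: cfM_cat => i ile; apply: contraNeq; rewrite mulf_eq0.
rewrite negb_or => /andP[_ /bn]; rewrite size_drop => dn; apply/eqP.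
by move: ile dn; rewrite -vn size_cat => ile; lia.
Qed.

Lemma cfM_top a b u v : deg_lt (size u).+1 a -> deg_lt (size v).+1 b ->
  cf (a * b) (u ++ v) = cf a u * cf b v.
Proof.
move=> au bv; apply: cfM_cat => i ile; apply: contraNeq; rewrite mulf_eq0.
rewrite negb_or => /andP[/au + /bv]; rewrite size_takel // size_drop.
by move: ile; rewrite size_cat => *; apply/eqP; lia.
Qed.

(** * Degree bounds, homogeneous components and leading words *)

Lemma deg_ltM m n a b :
  deg_lt m.+1 a -> deg_lt n.+1 b -> deg_lt (m + n).+1 (a * b).
Proof.
move=> am bn s; apply: contraNT; rewrite -leqNgt => mn; rewrite cfM big1 // => i _.
apply/eqP; apply: contraTT mn; rewrite mulf_eq0 negb_or => /andP[/am + /bn].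
have := ltn_ord i; rewrite size_drop ltnS => ile; rewrite size_takel // => *.
by lia.
Qed.

Lemma homogM m n a b : homog m a -> homog n b -> homog (m + n) (a * b).
Proof.
move=> am bn s; apply: contraNeq => mn; rewrite cfM big1 // => i _.
apply/eqP; apply: contraTT mn; rewrite mulf_eq0 negb_or negbK => /andP[/am + /bn].
have := ltn_ord i; rewrite size_drop ltnS => ile; rewrite size_takel // => *.
by apply/eqP; lia.
Qed.

Lemma deg_ltS m n a : (m <= n)%N -> deg_lt m a -> deg_lt n a.
Proof. by move=> mn am s /am /leq_trans; apply. Qed.

Lemma deg_ltD n a b : deg_lt n a -> deg_lt n b -> deg_lt n (a + b).
Proof.
move=> an bn s; have [a0|/an //] := eqVneq (cf a s) 0.
by rewrite cfD a0 add0r => /bn.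
Qed.

Lemma deg_ltN n a : deg_lt n a -> deg_lt n (- a).
Proof. by move=> an s; rewrite cfN oppr_eq0 => /an. Qed.

Lemma deg_ltB n a b : deg_lt n a -> deg_lt n b -> deg_lt n (a - b).
Proof. by move=> an /deg_ltN; exact: deg_ltD. Qed.

Lemma deg_lt_adj n a : deg_lt n a -> deg_lt n (adj a).
Proof. by move=> an s; rewrite cf_adj => /an; rewrite size_sword. Qed.

Lemma homog_adj n a : homog n a -> homog n (adj a).
Proof. by move=> an s; rewrite cf_adj => /an; rewrite size_sword. Qed.

Lemma homogD n a b : homog n a -> homog n b -> homog n (a + b).
Proof.
move=> an bn s; have [a0|/an //] := eqVneq (cf a s) 0.
by rewrite cfD a0 add0r => /bn.
Qed.

Lemma homogB n a b : homog n a -> homog n b -> homog n (a - b).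
Proof.
by move=> an bn; apply: homogD => // s; rewrite cfN oppr_eq0 => /bn.
Qed.

Lemma homogZ n c a : homog n a -> homog n (c *: a).
Proof. by move=> an s; rewrite cfZ mulf_eq0 negb_or => /andP[_ /an]. Qed.

Lemma deg_lt_sum n (r : nat) (F : 'I_r -> A) :
  (forall i, deg_lt n (F i)) -> deg_lt n (\sum_i F i).
Proof.
move=> Fn s; apply: contraNT => sn; rewrite cf_sum big1 // => i _.
by apply/eqP; apply: contraNT sn => /Fn.
Qed.

Lemma homog_sum n (r : nat) (F : 'I_r -> A) :
  (forall i, homog n (F i)) -> homog n (\sum_i F i).
Proof.
move=> Fn s; rewrite cf_sum; apply: contraNeq => sn; rewrite big1 // => i _.
by apply/eqP; apply: contraNT sn => /Fn ->.
Qed.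

Lemma homog_hpart n a : homog n (hpart n a).
Proof. by move=> s; rewrite hpartE; case: (size s =P n); rewrite ?eqxx. Qed.

Arguments homog_hpart : clear implicits.

Lemma hpart_homog n a : homog n a -> hpart n a = a.
Proof.
move=> an; apply: cf_inj => s; rewrite hpartE; case: eqVneq => // sn.
by apply/esym/eqP; apply: contraNT sn => /an ->.
Qed.

Lemma homog_deg_lt n a : homog n a -> deg_lt n.+1 a.
Proof. by move=> an s /an ->. Qed.

Lemma deg_lt0 a : deg_lt 0 a -> a = 0.
Proof.
by move=> a0; apply: cf_inj => s; rewrite cf0; apply/eqP/negPn/negP => /a0.
Qed.

Lemma deg_lt_hpart n a : deg_lt n.+1 a -> deg_lt n (a - hpart n a).
Proof.
move=> an s; rewrite cfB hpartE; case: (eqVneq (size s) n) => [|sn];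
  rewrite ?subrr ?eqxx //.
by rewrite subr0 => /an; rewrite ltnS leq_eqVlt (negbTE sn).
Qed.

Lemma hpart_eq0 n a : deg_lt n.+1 a -> hpart n a = 0 -> deg_lt n a.
Proof. by move=> /deg_lt_hpart + a0; rewrite a0 subr0. Qed.

Lemma exists_top a : a != 0 -> exists s, cf a s != 0 /\ deg_lt (size s).+1 a.
Proof.
move=> anz; have [n an] : exists n, deg_lt n a.
  exact: cf_bounded.
elim: n an => [/deg_lt0 /eqP|n IHn an]; first by rewrite (negbTE anz).
have [/(hpart_eq0 an) //|hnz] := eqVneq (hpart n a) 0.
have [s sn] : exists s, cf (hpart n a) s != 0.
  apply: contrapT => H; case/eqP: hnz; apply: cf_inj => s; rewrite cf0.
  by apply/eqP; apply: contrapT => /negP snz; apply: H; exists s.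
exists s; have sE := homog_hpart _ _ _ sn; move: sn; rewrite hpartE sE eqxx.
by split.
Qed.

Lemma hpartM m n a b : deg_lt m.+1 a -> deg_lt n.+1 b ->
  hpart (m + n) (a * b) = hpart m a * hpart n b.
Proof.
move=> am bn; apply: cf_inj => s; rewrite hpartE; case: eqVneq => [sE|sn].
  rewrite -(cat_take_drop m s).
  have tm : size (take m s) = m by rewrite size_takel // sE leq_addr.
  have dn : size (drop m s) = n by rewrite size_drop sE addKn.
  rewrite (cfM_top (a:=a) (b:=b)).
  2: by rewrite tm.
  2: by rewrite dn.
  rewrite (cfM_homogl (hpart n b) (drop m s) (homog_hpart m a) tm).
  by rewrite !hpartE tm dn !eqxx.
apply/esym/eqP; apply: contraNT sn => /(homogM (homog_hpart _ _) (homog_hpart _ _)).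
by move=> ->.
Qed.

Lemma hpart_adj n a : hpart n (adj a) = adj (hpart n a).
Proof. by apply: cf_inj => s; rewrite cf_adj !hpartE cf_adj size_sword. Qed.

Lemma hpartD n a b : hpart n (a + b) = hpart n a + hpart n b.
Proof.
by apply: cf_inj => s; rewrite cfD !hpartE cfD; case: eqP; rewrite ?addr0.
Qed.

Lemma hpartB n a b : hpart n (a - b) = hpart n a - hpart n b.
Proof.
by apply: cf_inj => s; rewrite cfB !hpartE cfB; case: eqP; rewrite ?subr0.
Qed.

Lemma hpart0 n : hpart n (0 : A) = 0.
Proof. by apply: cf_inj => s; rewrite hpartE !cf0 if_same. Qed.

Lemma hpart_sum n (r : nat) (F : 'I_r -> A) :
  hpart n (\sum_i F i) = \sum_i hpart n (F i).
Proof.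
by apply: (big_morph (hpart n)) => [a b|]; [exact: hpartD|exact: hpart0].
Qed.

Lemma wa_mulf_neq0 a b : a != 0 -> b != 0 -> a * b != 0.
Proof.
move=> /exists_top[u [au aT]] /exists_top[v [bv bT]]; apply/eqP => ab0.
by have := mulf_neq0 au bv; rewrite -cfM_top // ab0 cf0 eqxx.
Qed.

Lemma homog_ext n a b : homog n a -> homog n b ->
  (forall s, size s = n -> cf a s = cf b s) -> a = b.
Proof.
move=> an bn ab; apply: cf_inj => s; have [/ab //|sn] := eqVneq (size s) n.
transitivity (0 : R); last apply/esym; apply/eqP.
  by apply: contraNT sn => /an ->.
by apply: contraNT sn => /bn ->.
Qed.

Lemma homog0 n : homog n (0 : A).
Proof. by move=> s; rewrite cf0 eqxx. Qed.

Lemma wa_scalerAr (c : R) a b : a * (c *: b) = c *: (a * b).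
Proof.
apply: cf_inj => s; rewrite cfZ !cfM mulr_sumr; apply: eq_bigr => i _.
by rewrite cfZ mulrCA.
Qed.

Lemma adj_sum (r : nat) (F : 'I_r -> A) :
  adj (\sum_i F i) = \sum_i adj (F i).
Proof. by apply: big_morph; [exact: adjD|exact: adj0]. Qed.

Lemma adj_hermitian a : adj (adj a * a) = adj a * a.
Proof. by rewrite adjM adjK. Qed.

(** * Skew factorisation, and positivity of diagonal coefficients *)

Lemma cf_antisym_diag a s : adj a = - a -> cf a (sword s ++ s) = 0.
Proof.
move=> aN; have := cf_adj a (sword s ++ s).
rewrite aN cfN sword_cat swordK => /eqP.
by rewrite eq_sym -addr_eq0 -mulr2n mulrn_eq0 => /eqP.
Qed.

(** At the word zw the hypothesis reads x(z) y(w) = -y^*(z1) x^*(z2 w), where z = z1 z2 and z1 has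
    length d. So x is determined by its coefficients at words beginning with w^*. *)
Lemma antisym_factor d e x y w :
  homog d y -> homog e x -> (d <= e)%N -> size w = d -> cf y w != 0 ->
  (forall z, size z = e -> cf (x * y + adj y * adj x) (z ++ w) = 0) ->
  exists k, [/\ adj k = - k, homog (e - d) k & x = adj y * k].
Proof.
move=> yd xe de wd yw xy0; pose c := cf y w.
(* This strips w^* from the left of x: k(s) = x(w^* s) / c. *)
pose k := c^-1 *: adj (rquot w (adj x)).
have kE s : cf x (sword w ++ s) = c * cf k s.
  by rewrite cfZ cf_adj rquotE cf_adj sword_cat swordK mulVKf.
have xE z : size z = e ->
    cf x z = - cf (adj y) (take d z) * cf k (sword (drop d z)).
  move=> ze; have := xy0 z ze; rewrite cfD (cfM_homogr _ _ yd) //.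
  have tz : size (take d z) = d by rewrite size_takel // ze.
  have -> : z ++ w = take d z ++ (drop d z ++ w) by rewrite catA cat_take_drop.
  rewrite (cfM_homogl _ _ (homog_adj yd)) // [cf (adj x) _]cf_adj sword_cat kE.
  rewrite -/c => /eqP; rewrite addr_eq0 => /eqP xz.
  by apply: (mulIf yw); rewrite -/c xz; ring.
have kh : homog (e - d) k.
  move=> s ks; have /xe : cf x (sword w ++ s) != 0 by rewrite kE mulf_neq0.
  by rewrite size_cat size_sword wd => <-; rewrite addKn.
have kN : adj k = - k.
  apply: (homog_ext (homog_adj kh)) => [s|s sE].
    by rewrite cfN oppr_eq0 => /kh.
  have := xE (sword w ++ s); rewrite kE size_cat size_sword wd sE subnKC //.
  rewrite take_size_cat ?size_sword // drop_size_cat ?size_sword //.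
  rewrite !cf_adj swordK cfN -/c => /(_ erefl) kk.
  by apply: (mulfI yw); rewrite -/c mulrN kk; ring.
exists k; split=> //; have yk := homogM (homog_adj yd) kh; rewrite subnKC // in yk.
apply: (homog_ext xe yk) => z ze.
rewrite xE // -cf_adj kN cfN mulrNN -{3}(cat_take_drop d z).
by rewrite (cfM_homogl _ _ (homog_adj yd)) // size_takel // ze.
Qed.

Lemma cf_sos_diag n (r : nat) (a : 'I_r -> A) w :
  (forall i, deg_lt n.+1 (a i)) -> size w = n ->
  cf (\sum_i adj (a i) * a i) (sword w ++ w) = \sum_i cf (a i) w ^+ 2.
Proof.
move=> an wn; rewrite cf_sum; apply: eq_bigr => i _; rewrite cfM_top ?wn //.
  by rewrite cf_adj swordK expr2.
by rewrite size_sword wn; exact: deg_lt_adj.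
Qed.

(** Only top coefficients meet at w^* w, so the coefficient there is a sum of real squares. This is
    where positivity enters. *)
Lemma sos_diag_eq0 n (r : nat) (a : 'I_r -> A) w :
  (forall i, deg_lt n.+1 (a i)) -> size w = n ->
  cf (\sum_i adj (a i) * a i) (sword w ++ w) = 0 -> forall i, cf (a i) w = 0.
Proof.
move=> an wn; rewrite (cf_sos_diag an wn) => /psumr_eq0P a0 i; apply/eqP.
by rewrite -sqrf_eq0 a0 // => j _; exact: sqr_ge0.
Qed.

Lemma sos_homog_eq0 n (r : nat) (a : 'I_r -> A) :
  (forall i, homog n (a i)) -> \sum_i adj (a i) * a i = 0 ->
  forall i, a i = 0.
Proof.
move=> an a0 i; apply: (homog_ext (an i) (homog0 n)) => s sn; rewrite cf0.
apply: (sos_diag_eq0 (n := n)) => // [j|]; first exact: homog_deg_lt.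
by rewrite a0 cf0.
Qed.

(** * Reducing a sum of squares modulo left multiples *)

Lemma sos_sub (r : nat) (a b : 'I_r -> A) x y :
  \sum_i adj (a i) * a i = x * y + adj y * adj x ->
  let x' := x - \sum_i adj (a i) * b i
            + 2^-1 *: (adj y * \sum_i adj (b i) * b i) in
  \sum_i adj (a i - b i * y) * (a i - b i * y) = x' * y + adj y * adj x'.
Proof.
(* The self-adjoint term y^* (sum of b_i^* b_i) y is shared equally between x' y and its adjoint,
   hence the factor 1/2. *)
move=> axy /=; rewrite adjD adjB /= adjZ adjM adjK !adj_sum.
under [\sum_i adj (adj (b i) * b i)]eq_bigr do rewrite adj_hermitian.
under [\sum_i adj (adj (a i) * b i)]eq_bigr do rewrite adjM adjK.
rewrite !mulrDl !mulrDr !mulNr !mulrN wa_scalerAr -scalerAl.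
transitivity (\sum_i adj (a i) * a i - (\sum_i adj (a i) * b i) * y
    - adj y * (\sum_i adj (b i) * a i)
    + adj y * (\sum_i adj (b i) * b i) * y).
  rewrite !mulr_sumr !mulr_suml -!sumrB -big_split; apply: eq_bigr => i _ /=.
  rewrite adjB /= adjM mulrBl !mulrBr !mulrA opprB addrA.
  by rewrite -addrA addrC; apply: cf_inj => s; rewrite !(cfD, cfN); ring.
rewrite axy; apply: cf_inj => s; rewrite !(cfD, cfN, cfZ) !mulrA; lra.
Qed.

Lemma sos_factor d e D (r : nat) (a : 'I_r -> A) x y :
  (forall i, homog D (a i)) -> homog e x -> homog d y -> y != 0 -> (d <= D)%N ->
  (e + d = D + D)%N ->
  \sum_i adj (a i) * a i = x * y + adj y * adj x ->
  exists b : 'I_r -> A,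
    forall i, a i = b i * y /\ homog (D - d) (b i).
Proof.
move=> aD xe yd /exists_top[w [yw _]] dD edD axy; have wd := yd _ yw.
(* With this choice a_i - b_i y has no word ending in w. *)
pose c := cf y w; pose b i := c^-1 *: rquot w (a i).
have bh i : homog (D - d) (b i).
  apply: homogZ => s; rewrite rquotE => /aD; rewrite size_cat wd => <-.
  by rewrite addnK.
exists b => i; split=> //; apply/eqP; rewrite -subr_eq0; apply/eqP.
pose a' j := a j - b j * y.
have a'D j : homog D (a' j).
  by apply: homogB => //; have := homogM (bh j) yd; rewrite subnK.
have a'w j s : cf (a' j) (s ++ w) = 0.
  by rewrite cfB (cfM_homogr _ _ yd) // cfZ rquotE mulrAC mulVf // mul1r subrr.
have := sos_sub b axy; set x' := (X in let x' := X in _) => /= a'xy.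
have x'e : homog e x'.
  have De : (D + (D - d) = e)%N by lia.
  apply: homogD; first apply: homogB => //.
    by rewrite -De; apply: homog_sum => j; apply: homogM => //; exact: homog_adj.
  have -> : (e = d + ((D - d) + (D - d)))%N by lia.
  apply/homogZ/homogM; first exact: homog_adj.
  by apply: homog_sum => j; apply: homogM => //; exact: homog_adj.
have [||k [kN _ x'E]] := antisym_factor yd x'e _ wd yw.
- by lia.
- move=> z ze; rewrite -a'xy cf_sum big1 // => j _.
  rewrite -(cat_take_drop D z) -catA (cfM_homogl _ _ (homog_adj (a'D j))).
    by rewrite a'w mulr0.
  by rewrite size_takel // ze; lia.
apply: (sos_homog_eq0 a'D); rewrite a'xy x'E adjM adjK kN mulNr mulrN.
by rewrite -mulrA subrr.
Qed.

(** If d <= D, then p is divided out of the a_i. Otherwise e < D and h^* is divided out instead; a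
    nonzero quotient would make p an excluded multiple, so all a_i vanish. The degree condition on
    b_i is additive because for D < d it must force b_i = 0, which truncated D - d would not. *)
Lemma sos_dichotomy d e D (r : nat) (a : 'I_r -> A) h p :
  (forall i, homog D (a i)) -> homog e h -> homog d p -> p != 0 ->
  (e + d = D + D)%N -> \sum_i adj (a i) * a i = h * p + adj p * adj h ->
  ~ sos_skew_multiple p ->
  exists b : 'I_r -> A, forall i, a i = b i * p /\
    forall s, cf (b i) s != 0 -> (size s + d)%N = D.
Proof.
move=> aD he pd pnz edD ahp pN; have [dD|Dd] := leqP d D.
  have [b bE] := sos_factor aD he pd pnz dD edD ahp; exists b => i.
  have [-> bi] := bE i; split=> // s /bi ->.
  by rewrite subnK.
suff a0 i : a i = 0.
  by exists (fun=> 0) => i; rewrite a0 mul0r; split=> // s; rewrite cf0 eqxx.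
have [h0|hnz] := eqVneq h 0.
  by apply: (sos_homog_eq0 aD); rewrite ahp h0 adj0 mul0r mulr0 addr0.
have hsnz : adj h != 0 by rewrite -(inj_eq (inv_inj adjK)) adjK adj0.
have [|||b bE] :=
  sos_factor (x := adj p) (e := d) aD (homog_adj pd) (homog_adj he) hsnz.
- by lia.
- by rewrite addnC.
- by rewrite ahp !adjK addrC.
have bm j : homog (D - e) (b j) by have [] := bE j.
have aE j : a j = b j * adj h by have [] := bE j.
rewrite aE; have [->|bi] := eqVneq (b i) 0; first by rewrite mul0r.
case: pN; pose S := \sum_j adj (b j) * b j.
have SE : h * S * adj h = h * p + adj p * adj h.
  rewrite -ahp mulr_sumr mulr_suml; apply: eq_bigr => j _.
  by rewrite !aE adjM adjK !mulrA.
have SS : adj S = S.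
  by rewrite adj_sum; apply: eq_bigr => j _; rewrite adj_hermitian.
have Sm : homog ((D - e) + (D - e)) S.
  by apply: homog_sum => j; apply: homogM => //; exact: homog_adj.
(* As h S h^* = h p + p^* h^*, subtracting half of h S makes x h^* + h x^* vanish. *)
pose x := adj p - 2^-1 *: (h * S).
have xd : homog d x.
  apply: homogB; first exact: homog_adj.
  have -> : (d = e + ((D - e) + (D - e)))%N by lia.
  exact/homogZ/homogM.
have [w [hw _]] := exists_top hsnz; have we := homog_adj he hw.
have [||k [kN kd xE]] := antisym_factor (homog_adj he) xd _ we hw.
- by lia.
- move=> z _; rewrite /x adjK adjB adjK /= adjZ adjM SS.
  rewrite mulrBl mulrBr -scalerAl wa_scalerAr mulrA SE.
  by rewrite !(cfD, cfN, cfZ); lra.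
(* Since x = h k with k skew, p = x^* + S h^* / 2 equals (S - 2k) h^* / 2. *)
exists (D - e)%N, r, b, (- 2 *: k), (2^-1 *: adj h); split.
  split; first by lia.
  - by [].
  - by exists i.
  - by apply: homogZ; have -> : (D - e + (D - e) = d - e)%N by lia.
  - by rewrite adjZ kN scalerN.
have -> : p = adj (x + 2^-1 *: (h * S)) by rewrite /x subrK adjK.
rewrite xE adjK adjD /= adjZ !adjM SS kN wa_scalerAr mulrDl -!scalerAl.
by apply: cf_inj => s; rewrite mulNr !(cfZ, cfD, cfN) -/S; lra.
Qed.

(** Lowers the degree bound of the a_i by one, looking only at components of degree 2D. How the top
    component of h p + p^* h^* gets the required shape depends on p and is left as a hypothesis. *)
Lemma sos_step d D (r : nat) (a : 'I_r -> A) h p :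
  deg_lt d.+1 p -> hpart d p != 0 -> ~ sos_skew_multiple (hpart d p) ->
  (forall i, deg_lt D.+1 (a i)) ->
  \sum_i adj (a i) * a i = h * p + adj p * adj h ->
  hpart (D + D) (h * p + adj p * adj h) = 0 \/
    (exists e h', [/\ homog e h', (e + d = D + D)%N &
      hpart (D + D) (h * p + adj p * adj h)
      = h' * hpart d p + adj (hpart d p) * adj h']) ->
  exists b : 'I_r -> A, forall i, deg_lt D (a i - b i * p).
Proof.
move=> pd Pnz PN aD ahp top.
have aT : \sum_i adj (hpart D (a i)) * hpart D (a i)
          = hpart (D + D) (h * p + adj p * adj h).
  rewrite -ahp hpart_sum; apply: eq_bigr => i _.
  by rewrite (hpartM (deg_lt_adj (aD i)) (aD i)) hpart_adj.
have ah i : homog D (hpart D (a i)) by exact: homog_hpart.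
case: top => [T0|[e [h' [h'e edD T]]]].
  exists (fun=> 0) => i; rewrite mul0r subr0; apply: hpart_eq0 => //.
  by apply: (sos_homog_eq0 ah); rewrite aT.
rewrite T in aT.
have [b bE] := sos_dichotomy ah h'e (homog_hpart _ _) Pnz edD aT PN.
exists b => i; have [aiE bi] := bE i.
have [dD|Dd] := leqP d D; last first.
  have b0 : b i = 0.
    by apply: cf_inj => s; rewrite cf0; apply/eqP/negPn/negP => /bi; lia.
  by rewrite b0 mul0r subr0; apply: hpart_eq0; rewrite // aiE b0 mul0r.
have bh : homog (D - d) (b i) by move=> s /bi <-; rewrite addnK.
have DE : (D - d + d = D)%N by rewrite subnK.
have bp := deg_ltM (homog_deg_lt bh) pd; rewrite DE in bp.
apply: hpart_eq0; first exact: deg_ltB.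
have := hpartM (homog_deg_lt bh) pd; rewrite DE (hpart_homog bh) -aiE => E.
by rewrite hpartB E subrr.
Qed.

(** * Realness of a principal left ideal by descent on the degree *)

Lemma exists_deg_lt a : exists n, deg_lt n a.
Proof.
have [->|/exists_top[s [_ sa]]] := eqVneq a 0; last by exists (size s).+1.
by exists 0%N => s; rewrite cf0 eqxx.
Qed.

Lemma exists_deg_lt_family (r : nat) (a : 'I_r -> A) :
  exists n, forall i, deg_lt n (a i).
Proof.
have [f fa] := fin_all_exists (fun i => exists_deg_lt (a i)).
by exists (\max_i f i) => i; apply: deg_ltS (fa i); exact: leq_bigmax.
Qed.

(** Realness of the left ideal of p, with elements of I + I^* written as h p plus its adjoint.
    Averaging a self-adjoint element with its adjoint always gives this form. *)
Definition strongly_real p : Prop :=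
  forall (r : nat) (a : 'I_r -> A) h,
    \sum_i adj (a i) * a i = h * p + adj p * adj h ->
    forall i, exists c, a i = c * p.

(** By [sos_sub] the reduced family satisfies an equation of the same kind, so the step can be
    iterated. *)
Lemma strongly_real_of_step p :
  (forall D (r : nat) (a : 'I_r -> A) h,
     (forall i, deg_lt D.+1 (a i)) ->
     \sum_i adj (a i) * a i = h * p + adj p * adj h ->
     exists b : 'I_r -> A, forall i, deg_lt D (a i - b i * p)) ->
  strongly_real p.
Proof.
move=> step r a h ahp; have [n an] := exists_deg_lt_family a.
elim: n => [|n IHn] in a h ahp an *.
  by move=> i; exists 0; rewrite mul0r; exact: deg_lt0.
have [b bE] := step _ _ _ _ an ahp.
move=> i; have /= /IHn /(_ bE i) [c cE] := sos_sub b ahp.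
by exists (c + b i); rewrite mulrDl -cE subrK.
Qed.

Lemma strongly_real_homog d p :
  homog d p -> p != 0 -> ~ sos_skew_multiple p -> strongly_real p.
Proof.
move=> pd pnz pN; apply: strongly_real_of_step => D r a h aD ahp.
have pE := hpart_homog pd.
apply: (sos_step (d := d) (h := h)) => //; rewrite ?pE //; first exact: homog_deg_lt.
(* Multiplying by the homogeneous p shifts components by d, whatever the degree of h; the case split
   guards against truncated n - d. *)
have hM n : hpart n (h * p) = if (d <= n)%N then hpart (n - d) h * p else 0.
  apply: cf_inj => s; case: leqP => [dn|nd]; last first.
    rewrite hpartE cf0; case: eqP => // sn; rewrite cfM big1 // => i _.
    apply/eqP; rewrite mulf_eq0; apply/orP; right; apply/negPn/negP => /pd.
    by rewrite size_drop; lia.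
  have hph := homogM (homog_hpart (n - d) h) pd; rewrite subnK // in hph.
  rewrite hpartE; case: eqP => [sn|/eqP sn]; last first.
    by apply/esym/eqP; apply: contraNT sn => /hph ->.
  have tn : size (take (n - d) s) = (n - d)%N by rewrite size_takel // sn leq_subr.
  rewrite -(cat_take_drop (n - d) s) !(cfM_homogr _ _ pd); last 2 first.
  - by rewrite size_drop sn subKn.
  - by rewrite size_drop sn subKn.
  by rewrite hpartE tn eqxx.
rewrite hpartD -adjM hpart_adj hM.
case: leqP => [dD|_]; last by left; rewrite adj0 addr0.
right; exists (D + D - d)%N, (hpart (D + D - d) h); split; first exact: homog_hpart.
  by rewrite subnK.
by rewrite adjM.
Qed.

(** * Polynomials in which no word mixes starred and unstarred letters *)

Definition pure p : Prop :=
  forall s, cf p s != 0 -> exists z, all (fun l : letter g => l.2 == z) s.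

(** A letter of t or u fixes the kind of every letter in both words, but passing from s to s^* flips
    the kind. *)
Lemma pure_cat_sword p s t u : pure p -> cf p (t ++ s ++ u) != 0 ->
  cf p (t ++ sword s ++ u) != 0 -> (0 < size (t ++ u))%N -> s = [::].
Proof.
move=> pp /pp[z1 z1P] /pp[z2 z2P] tu.
have z12 : z1 = z2.
  case tuE: (t ++ u) tu => [|l x] // _.
  have ltu : l \in t ++ u by rewrite tuE mem_head.
  have lin v : l \in t ++ v ++ u.
    by move: ltu; rewrite !mem_cat => /orP[] ->; rewrite ?orbT.
  by have /eqP <- := allP z1P _ (lin s); have /eqP <- := allP z2P _ (lin (sword s)).
case: s => // l s in z1P z2P *.
have /eqP l1 : l.2 == z1 by apply: (allP z1P); rewrite !mem_cat mem_head orbT.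
have /eqP l2 : (star_letter l).2 == z2.
  by apply: (allP z2P); rewrite !mem_cat mem_rev mem_head orbT.
by move: l2; rewrite -z12 -l1 /=; case: l.2.
Qed.

Lemma pure_sword_diag p s u : pure p -> cf p (sword s ++ s ++ u) != 0 -> s = [::].
Proof.
move=> pp /pp[z /allP zP]; case: s => // l s in zP *.
have /eqP l1 : l.2 == z by apply: zP; rewrite !mem_cat mem_head !orbT.
have /eqP : (star_letter l).2 == z by apply: zP; rewrite !mem_cat mem_rev mem_head.
by rewrite -l1 /=; case: l.2.
Qed.

Lemma pure_hpart n p : pure p -> pure (hpart n p).
Proof.
by move=> pp s; rewrite hpartE; case: (size s == n) => [/pp|]; rewrite ?eqxx.
Qed.

Lemma pure_adj p : pure p -> pure (adj p).
Proof.
move=> pp s; rewrite cf_adj => /pp[z zP]; exists (~~ z).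
move: zP; rewrite all_rev all_map; apply: sub_all => l /= /eqP <-.
by rewrite negbK.
Qed.

(** The word w^* w is its own adjoint, so the skew q vanishes there and cannot cancel the
    squares. *)
Lemma sos_skew_diag_neq0 m (r : nat) (c : 'I_r -> A) q i w :
  (forall j, deg_lt m.+1 (c j)) -> adj q = - q -> cf (c i) w != 0 ->
  size w = m -> cf (\sum_j adj (c j) * c j + q) (sword w ++ w) != 0.
Proof.
move=> cm qN cw wm; rewrite cfD [cf q _]cf_antisym_diag // addr0.
by apply: contraNneq cw => /(sos_diag_eq0 cm wm) ->.
Qed.

Lemma pure_not_skew_multiple p : pure p -> p != 0 -> ~ sos_skew_multiple p.
Proof.
move=> pp pnz [m [r [c [q [f [[m0 cm [i ci] qm qN] pE]]]]]].
have [w [cw _]] := exists_top ci; have wm := cm _ _ cw.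
have /exists_top[v [fv _]] : f != 0.
  by apply: contraNneq pnz => f0; rewrite pE f0 mulr0.
have sm : homog (m + m) (\sum_j adj (c j) * c j + q).
  apply: homogD => //; apply: homog_sum => j.
  by apply: homogM => //; exact: homog_adj.
have wnz : cf p (sword w ++ w ++ v) != 0.
  rewrite pE catA (cfM_homogl _ _ sm); last by rewrite size_cat size_sword wm.
  rewrite mulf_neq0 // (sos_skew_diag_neq0 _ qN cw wm) // => j.
  exact: homog_deg_lt.
by move: m0; rewrite -wm (pure_sword_diag pp wnz).
Qed.

(** Descent on the degree N of h. While N + d > M, the leading parts H of h and P of p satisfy H P +
    P^* H^* = 0. If d <= N, then H = P^* k and h can be lowered; if N < d, then P^* = H k with k
    skew, and purity leaves only constant h. *)
Lemma pure_reduce d M h p T :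
  pure p -> (0 < d)%N -> deg_lt d.+1 p -> hpart d p != 0 -> deg_lt M.+1 T ->
  T = h * p + adj p * adj h ->
  (exists2 h', T = h' * p + adj p * adj h' &
     forall s, cf h' s != 0 -> (size s + d <= M)%N) \/
  (exists2 c : R, c != 0 & T = c *: (p + adj p)).
Proof.
move=> pp d0 pd Pnz TM; have [N hN] := exists_deg_lt h.
elim: N => [|N IHN] in h hN * => TE.
  by left; exists h => // s; rewrite (deg_lt0 hN) cf0 eqxx.
have [NM|MN] := leqP (N + d) M.
  by left; exists h => // s /hN; rewrite ltnS => sN; lia.
have [h0|hnz] := eqVneq (hpart N h) 0; first by apply: (IHN h) => //; exact: hpart_eq0.
have top0 : hpart N h * hpart d p + adj (hpart d p) * adj (hpart N h) = 0.
  rewrite -!hpart_adj -(hpartM hN pd) -(hpartM (deg_lt_adj pd) (deg_lt_adj hN)).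
  rewrite addnC -hpartD -TE; apply: cf_inj => s; rewrite hpartE cf0.
  case: eqP => // sdN; apply/eqP/negPn/negP => /TM; lia.
have Ph := homog_hpart d p; have hh := homog_hpart N h.
have [dN|Nd] := leqP d N.
  have [w [Pw _]] := exists_top Pnz.
  have [|k [kN kh hE]] := antisym_factor Ph hh dN (Ph _ Pw) Pw.
    by move=> z _; rewrite top0 cf0.
  (* As k is skew, this cancels the leading part of h and leaves h p + p^* h^* unchanged. *)
  apply: (IHN (h - adj p * k)).
    have pk := deg_ltM (deg_lt_adj pd) (homog_deg_lt kh).
    rewrite subnKC // in pk; apply: hpart_eq0; first exact: deg_ltB.
    have := hpartM (deg_lt_adj pd) (homog_deg_lt kh).
    rewrite subnKC // hpartB => ->.
    by rewrite hpart_adj (hpart_homog kh) hE subrr.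
  rewrite TE adjB adjM adjK kN mulrBl mulrBr mulNr mulrN opprK mulrA.
  by rewrite addrACA addrC; apply: cf_inj => s; rewrite !(cfD, cfN); ring.
have hsnz : adj (hpart N h) != 0 by rewrite -(inj_eq (inv_inj adjK)) adjK adj0.
have [w [hw _]] := exists_top hsnz.
have hsh := homog_adj hh.
have [|k [kN kh PE]] := antisym_factor hsh (homog_adj Ph) (ltnW Nd) (hsh _ hw) hw.
  by move=> z _; rewrite !adjK addrC top0 cf0.
rewrite adjK in PE.
have knz : k != 0.
  by apply: contraNneq Pnz => k0; rewrite -[hpart d p]adjK PE k0 mulr0 adj0.
have [u [ku _]] := exists_top knz; have [v [hv _]] := exists_top hnz.
have uE := kh _ ku; have vE := hh _ hv.
have Pvu t : cf k t != 0 -> cf (adj (hpart d p)) (v ++ t ++ [::]) != 0.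
  by move=> kt; rewrite cats0 PE (cfM_homogl _ _ hh) // mulf_neq0.
(* With u also u^* occurs in k, which has positive degree. If v were nonempty, v u and v u^* would
   both occur in the pure P^*, which is impossible. *)
have v0 : v = [::].
  apply/eqP; rewrite -size_eq0 -leqn0 leqNgt; apply/negP => v0.
  have u0 : u = [::].
    apply: (pure_cat_sword (t := v) (u := [::]) (pure_adj (pure_hpart pp))).
    - exact: Pvu.
    - by apply: Pvu; rewrite -cf_adj kN cfN oppr_eq0.
    - by rewrite cats0.
  by move: Nd; rewrite -subn_gt0 -uE u0.
have N0 : N = 0%N by rewrite -vE v0.
rewrite N0 in hN hnz hv; right; exists (cf h [::]).
  by move: hv; rewrite v0 hpartE.
have hE : h = cf h [::] *: 1.
  apply: cf_inj => s; rewrite cfZ cf1; case: eqP => [->|/eqP s0]; rewrite ?mulr1 //.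
  rewrite mulr0; apply/eqP/negPn/negP => /hN.
  by rewrite ltnS leqn0 size_eq0 (negbTE s0).
rewrite TE; move: (cf h [::]) hE => c ->.
by rewrite adjZ adj1 wa_scalerAr mulr1 -scalerAl mul1r scalerDr.
Qed.

(** The excluded condition says that p + p^* is a nonzero constant. In the second case of
    [pure_reduce], a word s of length D in some a_i puts s^* s into p + p^*; purity makes s empty,
    so D = 0 and the excluded condition follows. *)
Lemma strongly_real_pure d p :
  pure p -> (0 < d)%N -> deg_lt d.+1 p -> hpart d p != 0 ->
  ~ (cf p [::] <> 0 /\ forall s, s != [::] -> cf p s + cf p (sword s) = 0) ->
  strongly_real p.
Proof.
move=> pp d0 pd Pnz pN; apply: strongly_real_of_step => D r a h aD ahp.
pose T := \sum_i adj (a i) * a i.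
have TD : deg_lt (D + D).+1 T.
  apply: deg_lt_sum => i; apply: deg_ltM (aD i); exact/deg_lt_adj/aD.
have [[h' Th' h'D]|[c c0 Tc]] := pure_reduce pp d0 pd Pnz TD ahp.
  apply: (sos_step pd Pnz _ aD Th').
    exact: pure_not_skew_multiple (pure_hpart pp) Pnz.
  have [dD|Dd] := leqP d (D + D); last first.
    left; suff -> : h' = 0 by rewrite adj0 mul0r mulr0 addr0 hpart0.
    by apply: cf_inj => s; rewrite cf0; apply/eqP/negPn/negP => /h'D; lia.
  right; exists (D + D - d)%N, (hpart (D + D - d) h'); rewrite subnK //.
  have h'b : deg_lt (D + D - d).+1 h' by move=> s /h'D; lia.
  have := hpartM h'b pd; rewrite subnK // => h'p.
  split=> //; first exact: homog_hpart.
  by rewrite hpartD -adjM hpart_adj h'p adjM.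
exists (fun=> 0) => i; rewrite mul0r subr0 => s sa.
have := aD i s sa; rewrite ltnS leq_eqVlt => /orP[/eqP sD|//]; case: pN.
have Tnz : cf T (sword s ++ s) != 0.
  by apply: contraNneq sa => /(sos_diag_eq0 aD sD) ->.
have pnz : cf p (sword s ++ s ++ [::]) != 0.
  move: Tnz; rewrite Tc cfZ cfD cf_adj sword_cat swordK cats0 => /eqP Tnz.
  by apply/eqP => p0; apply: Tnz; rewrite p0 addr0 mulr0.
have s0 := pure_sword_diag pp pnz; move: pnz; rewrite s0 => /eqP pnz; split=> // t t0.
have : cf T t = 0.
  by apply/eqP/negPn/negP => /TD; rewrite -sD s0 ltnS leqn0 size_eq0 (negbTE t0).
by rewrite Tc cfZ cfD cf_adj => /eqP; rewrite mulf_eq0 (negbTE c0) => /eqP.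
Qed.

(** * Obstructions to realness *)

Lemma sos_top (r : nat) (a : 'I_r -> A) w :
  w != [::] -> cf (\sum_i adj (a i) * a i) w != 0 ->
  exists D, [/\ (0 < D)%N, forall i, deg_lt D.+1 (a i) &
    exists i v, cf (a i) v != 0 /\ size v = D].
Proof.
move=> w0 sw; have [n an] := exists_deg_lt_family a.
elim: n an => [|n IHn] an.
  case/eqP: sw; rewrite big1 ?cf0 // => i _.
  by rewrite (deg_lt0 (an i)) mulr0.
have [[i [v [av vn]]]|nN] := pselect (exists i v, cf (a i) v != 0 /\ size v = n).
  exists n; split=> //; last by exists i, v.
  rewrite lt0n; apply: contraNneq w0 => n0; rewrite n0 in an.
  have sD : deg_lt 1 (\sum_i adj (a i) * a i).
    apply: deg_lt_sum => j; apply: (@deg_ltM 0 0) (an j); exact/deg_lt_adj/an.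
  by have := sD _ sw; rewrite ltnS leqn0 size_eq0.
apply: IHn => i s sa; have := an i s sa; rewrite ltnS leq_eqVlt => /orP[/eqP sn|//].
by case: nN; exists i, s.
Qed.

Lemma skew_multiple_not_strongly_real (r : nat) (a : 'I_r -> A) q f w :
  w != [::] -> cf (\sum_i adj (a i) * a i) w != 0 -> adj q = - q -> f != 0 ->
  ~ strongly_real ((\sum_i adj (a i) * a i + q) * f).
Proof.
move=> w0 sw qN fnz; have [D [D0 aD [i [v [av vD]]]]] := sos_top w0 sw.
have := sos_skew_diag_neq0 aD qN av vD.
have SS : adj (\sum_j adj (a j) * a j) = \sum_j adj (a j) * a j.
  by rewrite adj_sum; apply: eq_bigr => j _; rewrite adj_hermitian.
set S := \sum_j _ in SS * => sqv pR.
(* The skew part cancels in f^* p + p^* f = 2 f^* S f, whence the multiplier f^* / 2. *)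
have [|c cE] := pR r (fun j => a j * f) (2^-1 *: adj f) _ i.
  transitivity (adj f * S * f).
    rewrite mulr_sumr mulr_suml; apply: eq_bigr => j _.
    by rewrite adjM !mulrA.
  rewrite adjZ adjK !adjM adjD SS qN wa_scalerAr -scalerAl !mulrA.
  rewrite !mulrDr !mulrDl mulrN mulNr.
  by apply: cf_inj => s; rewrite !(cfD, cfZ, cfN); lra.
have aE : a i = c * (S + q).
  apply/eqP; rewrite -subr_eq0; apply/negPn/negP => /wa_mulf_neq0 /(_ fnz).
  by rewrite mulrBl cE mulrA subrr eqxx.
have cnz : c != 0.
  by apply: contraNneq av => c0; rewrite aE c0 mul0r cf0.
have Sqnz : S + q != 0 by apply: contraNneq sqv => ->; rewrite cf0.
(* S + q has a word of length 2D, so its nonzero multiple a_i would have degree at least 2D > D. *)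
have [u [cu uT]] := exists_top cnz; have [t [St tT]] := exists_top Sqnz.
have vt := tT _ sqv; rewrite size_cat size_sword vD ltnS in vt.
have : cf (a i) (u ++ t) != 0 by rewrite aE cfM_top // mulf_neq0.
by move=> /(aD i); rewrite size_cat; lia.
Qed.

(** Here the square 1 lies in I + I^*, so realness would give 1 = b p, against the positive degree
    of p. *)
Lemma adj_shift_not_strongly_real (c : R) p w :
  w != [::] -> cf p w != 0 -> c != 0 -> p + adj p = c *: 1 -> ~ strongly_real p.
Proof.
move=> w0 pw c0 pc pR.
have [|b bE] := pR 1%N (fun=> 1) (c^-1 *: 1) _ ord0.
  rewrite big_ord1 adjZ adj1 wa_scalerAr !mulr1 -scalerAl mul1r -scalerDr pc.
  by rewrite scalerA mulVf // scale1r.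
have one_nz : (1 : A) != 0.
  apply/eqP => /(congr1 (fun a : A => cf a [::])); rewrite cf1 cf0 => /eqP.
  by rewrite oner_eq0.
have bnz : b != 0 by apply: contraNneq one_nz => b0; rewrite bE b0 mul0r.
have pnz : p != 0 by apply: contraNneq pw => ->; rewrite cf0.
have [u [bu uT]] := exists_top bnz; have [t [pt tT]] := exists_top pnz.
have : cf (1 : A) (u ++ t) != 0 by rewrite bE cfM_top // mulf_neq0.
have := tT _ pw; case: t pt tT => [|l t] _ _.
  by rewrite ltnS leqn0 size_eq0 (negbTE w0).
by rewrite cf1; case: u {bu uT} => [|? ?] _; rewrite eqxx.
Qed.

Lemma strongly_realW p : strongly_real p ->
  forall (r : nat) (a : 'I_r -> A) (h t : A),
    h * p + adj (t * p) = \sum_i adj (a i) * a i ->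
    forall i, exists c, a i = c * p.
Proof.
move=> pR r a h t ahp; apply: (pR r a (2^-1 *: (h + t))).
have aS : adj (\sum_i adj (a i) * a i) = \sum_i adj (a i) * a i.
  by rewrite adj_sum; apply: eq_bigr => j _; rewrite adj_hermitian.
have := aS; rewrite -{}ahp adjD adjK !adjM => E.
rewrite -scalerAl adjZ wa_scalerAr adjD mulrDl mulrDr.
apply: cf_inj => s; have := congr1 (fun u : A => cf u s) E.
by rewrite !(cfZ, cfD) => {}E; lra.
Qed.

End WordAlg.

(** * The free algebra as an instance of the abstract view *)

Section Polynomials.
Context {R : realType} {g : nat}.
Implicit Types (a b p : ncpoly R g) (s v : seq (letter g)).

Definition nc_hpart (n : nat) a : ncpoly R g :=
  [malg w in msupp a => if fdeg w == n then a@_w else 0].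

(** The finite set given as domain contains every s with s v in the support of a; at its other
    elements the coefficient at s v is read as well and is zero. *)
Definition nc_rquot v a : ncpoly R g :=
  [malg s in [fset FMonom (take (size (fmonom_val w) - size v)%N (fmonom_val w))
                 | w in msupp a]%fset
     => a@_(FMonom (fmonom_val s ++ v))].

Lemma mcoeff_inj a b :
  (forall s, a@_(FMonom s) = b@_(FMonom s)) -> a = b.
Proof. by move=> ab; apply/malgP => -[s]; exact: ab. Qed.

Lemma mcoeff_bounded a :
  exists n, forall s, a@_(FMonom s) != 0 -> (size s < n)%N.
Proof.
exists (\max_(w <- msupp a) (fdeg w)).+1 => s; rewrite mcoeff_neq0 ltnS => sa.
by rewrite -[size s]/(fdeg (FMonom s)); apply: leq_bigmax_seq.
Qed.

Lemma mcoeff_nc1 s : (1 : ncpoly R g)@_(FMonom s) = (s == [::])%:R.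
Proof. by rewrite mcoeff1; congr (_ %:R); rewrite -val_eqE /= fm1. Qed.

Lemma mcoeff_ncM a b s :
  (a * b)@_(FMonom s) = \sum_(i < (size s).+1)
    a@_(FMonom (take i s)) * b@_(FMonom (drop i s)).
Proof.
(* Each pair of support words gets an indicator for every cut of s; it matches at most one cut, the
   one at the length of k. *)
transitivity (\sum_(k <- msupp a) \sum_(l <- msupp b)
    \sum_(i < (size s).+1) (a@_k * b@_l) *+ (k == FMonom (take i s)) *+
       (l == FMonom (drop i s))).
  rewrite mcoeffMl; apply: eq_bigr => -[k] _; apply: eq_bigr => -[l] _.
  have [/= kls|nkls] := eqVneq (mmul (FMonom k) (FMonom l)) (FMonom s).
    have {kls} <- : k ++ l = s by rewrite -[s]/(val (FMonom s)) -kls /= fmM.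
    have kP : (size k < (size (k ++ l)).+1)%N by rewrite size_cat ltnS leq_addr.
    rewrite (bigD1 (Ordinal kP)) //= take_size_cat // drop_size_cat // !eqxx.
    rewrite big1 ?addr0 // => i; rewrite -val_eqE /= => ik.
    case: eqP; last by rewrite mulr0n mul0rn.
    by case=> kE; case/eqP: ik; rewrite {2}kE size_takel // -ltnS.
  rewrite mulr0n big1 // => i _; case: eqP => [ki|]; last by rewrite mulr0n mul0rn.
  case: eqP => [li|]; rewrite ?mulr0n //; case/eqP: nkls.
  by apply/val_inj; rewrite /= fmM ki li /= cat_take_drop.
under eq_bigr => k _ do rewrite exchange_big /=.
rewrite exchange_big /=; apply: eq_bigr => i _.
rewrite [in RHS](monalgE a) [in RHS](monalgE b) !raddf_sum /= mulr_suml.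
apply: eq_bigr => k _; rewrite mulr_sumr; apply: eq_bigr => l _.
by rewrite !mcoeffU mulrnAr mulrnAl.
Qed.

Lemma nc_hpartE n a s :
  (nc_hpart n a)@_(FMonom s) = if size s == n then a@_(FMonom s) else 0.
Proof. by rewrite mcoeffE fdegE; case: msuppP => // _; rewrite if_same. Qed.

Lemma nc_rquotE v a s : (nc_rquot v a)@_(FMonom s) = a@_(FMonom (s ++ v)).
Proof.
rewrite mcoeffE; case: ifP => // /negbT; apply: contraNeq => anz.
apply/imfsetP; exists (FMonom (s ++ v)); first by rewrite -mcoeff_neq0 eq_sym.
by rewrite /= size_cat addnK take_size_cat.
Qed.

Definition nc_wordAlg : wordAlg R g :=
  @WordAlg R g (ncpoly R g) (fun a s => a@_(FMonom s)) (@star R g)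
    nc_hpart nc_rquot mcoeff_inj mcoeff_bounded
    (fun a b s => mcoeffD (FMonom s) a b) (fun c a s => mcoeffZ c a (FMonom s))
    mcoeff_nc1 mcoeff_ncM (fun a s => mcoeff_star a (FMonom s)) nc_hpartE nc_rquotE.

Lemma real_idealP p :
  real_ideal (lideal_gen p) <-> @strongly_real R g nc_wordAlg p.
Proof.
split=> [pR r a h ahp i|
  pR r a [_ /lideal_genP[h ->] [_ [_ /lideal_genP[t ->] <-] ahp]] i].
  apply/lideal_genP; apply: pR; exists (h * p); first by apply/lideal_genP; exists h.
  exists (star (h * p)); last by rewrite starM -ahp.
  by exists (h * p) => //; apply/lideal_genP; exists h.
by apply/lideal_genP; exact: (strongly_realW pR ahp).
Qed.

(** * Back to constant, homogeneous and analytic polynomials *)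

Lemma not_constantP a :
  ~ constant_poly a <-> exists2 s, s != [::] & a@_(FMonom s) != 0.
Proof.
split=> [aN|[s s0 sa] [c ac]]; last first.
  by move: sa; rewrite ac mcoeffC -val_eqE /= fm1 (negbTE s0) mulr0n eqxx.
apply: contrapT => aS; apply: aN; exists a@_(FMonom [::]).
apply: mcoeff_inj => s; rewrite mcoeffC -val_eqE /= fm1.
have [-> //|s0] := eqVneq s [::]; rewrite mulr0n; apply/eqP/negPn/negP => sa.
by apply: aS; exists s.
Qed.

Lemma homogeneousP p :
  homogeneous p -> exists d, homog (A := nc_wordAlg) d p.
Proof. by move=> [d pd]; exists d => s /=; rewrite mcoeff_neq0 => /pd. Qed.

Lemma analytic_coeff a s : analytic a -> a@_(FMonom s) != 0 ->
  all (fun l : letter g => l.2 == false) s.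
Proof.
rewrite mcoeff_neq0 => aa /aa sa; apply/allP => -[i []] //= si.
by have := sa i; rewrite si.
Qed.

Lemma pure_analyticD a b :
  analytic a -> analytic b -> pure (A := nc_wordAlg) (a + star b).
Proof.
move=> aa ab s /=; rewrite mcoeffD.
have [a0|an _] := eqVneq a@_(FMonom s) 0; last first.
  by exists false; exact: analytic_coeff aa an.
rewrite a0 add0r mcoeff_star => /(analytic_coeff ab) => sT; exists true.
move: sT; rewrite all_rev all_map; apply: sub_all => -[i c] /=.
by case: c.
Qed.

(** A nonempty word or its adjoint contains a starred letter; this tells a from b^* in a + b^*. *)
Lemma analytic_coeff_sword s : s != [::] ->
  (forall a, analytic a -> a@_(FMonom s) = 0) \/
  (forall a, analytic a -> a@_(FMonom (sword s)) = 0).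
Proof.
move=> s0; have [sF|sT] := boolP (all (fun l : letter g => l.2 == false) s).
  right=> a aa; case: s s0 sF => // l s _ /andP[/eqP l0 _].
  apply/eqP/negPn/negP => /(analytic_coeff aa) /allP /(_ (star_letter l)).
  by rewrite mem_rev mem_head /= l0 => /(_ isT).
by left=> a aa; apply/eqP; apply: contraNT sT => /(analytic_coeff aa).
Qed.

Definition skew_sos_multiple p : Prop :=
  exists s q f : ncpoly R g,
    [/\ sum_of_squares s, ~ constant_poly s, star q = - q & p = (s + q) * f].

Lemma skew_multiple_not_real p :
  p <> 0 -> skew_sos_multiple p -> ~ real_ideal (lideal_gen p).
Proof.
move=> pnz [s [q [f [[r [a ->]] /not_constantP[w w0 sw] qN pE]]]] /real_idealP.
rewrite pE; apply: (skew_multiple_not_strongly_real (A := nc_wordAlg) w0 sw qN).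
by apply/eqP => f0; apply: pnz; rewrite pE f0 mulr0.
Qed.

(** A homogeneous witness is also one in the general sense: its sum of squares is nonzero at the
    nonempty word w^* w, hence nonconstant. *)
Lemma homogeneous_real p : p <> 0 -> homogeneous p -> ~ skew_sos_multiple p ->
  real_ideal (lideal_gen p).
Proof.
move=> /eqP pnz /homogeneousP[d pd] pN; apply/real_idealP.
apply: (strongly_real_homog pd) => // -[m [r [c [q [f [[m0 cm [i ci] qm qN] pE]]]]]].
apply: pN; exists (\sum_i star (c i) * c i), q, f; split=> //; first by exists r, c.
have [w [cw _]] := exists_top ci; have wm := cm _ _ cw.
apply/not_constantP; exists (sword w ++ w).
  by rewrite -size_eq0 size_cat size_sword; have := wm; lia.
have cmt j := homog_deg_lt (cm j).
apply/negP => /eqP /(sos_diag_eq0 (A := nc_wordAlg) cmt wm) /(_ i) ci0.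
by rewrite ci0 eqxx in cw.
Qed.

Lemma analytic_shift_of_not_real a b p :
  analytic a -> analytic b -> ~ constant_poly p -> p = a + star b ->
  ~ real_ideal (lideal_gen p) ->
  exists c : R, c <> 0 /\ p = a - star a + c%:MP.
Proof.
move=> aa ab /not_constantP[w w0 pw] pE pR; apply: contrapT => pN.
apply/pR/real_idealP; have pnz : p != 0.
  by apply: contraNneq pw => ->; rewrite mcoeff0.
have [t [pt tT]] := exists_top (A := nc_wordAlg) pnz.
have pp : pure (A := nc_wordAlg) p by rewrite pE; exact: pure_analyticD.
apply: (strongly_real_pure pp _ tT) => [||[c0 pS]].
- by rewrite lt0n size_eq0; apply: contraTneq (tT _ pw) => ->;
    rewrite ltnS leqn0 size_eq0.
- apply: contraNneq pt => h0.
  by rewrite -[X in _ == X](cf0 (A := nc_wordAlg) t) -h0 hpartE eqxx.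
(* The constant is the coefficient at the empty word. At a nonempty s, p + p^* vanishes, and a and b
   both vanish at s or both at its adjoint, which gives the identity. *)
apply: pN; exists p@_(FMonom [::]); split=> //; apply: mcoeff_inj => s.
have starE (c : ncpoly R g) u : (star c)@_(FMonom u) = c@_(FMonom (sword u)).
  exact: mcoeff_star.
rewrite mcoeffD mcoeffB starE mcoeffC -val_eqE /= fm1.
have [-> /=|s0] := eqVneq s [::]; first by rewrite mulr1n subrr add0r.
have := pS s s0; rewrite /= pE !mcoeffD !starE swordK mulr0n addr0.
have [z|z] := analytic_coeff_sword s0; rewrite !(z _ aa) !(z _ ab); lra.
Qed.

Lemma analytic_shift_not_real a p (c : R) :
  ~ constant_poly p -> c <> 0 -> p = a - star a + c%:MP ->
  ~ real_ideal (lideal_gen p).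
Proof.
move=> /not_constantP[w w0 pw] /eqP c0 pE /real_idealP.
(* The part a - a^* is skew, so p + p^* = 2c. *)
apply: (adj_shift_not_strongly_real (A := nc_wordAlg) (c := c *+ 2) w0 pw).
  by rewrite mulrn_eq0.
transitivity (p + star p) => //.
rewrite pE raddfD raddfB /= starK starC -mul_malgC mulr1 raddfMn /= mulr2n.
by apply: mcoeff_inj => s; rewrite !(mcoeffD, mcoeffN); ring.
Qed.

(** Both equations say a + b = c: cancel a and take adjoints in the first, cancel b^* in the
    second. *)
Lemma analytic_shift_swap a b (c : R) :
  (a + star b = a - star a + c%:MP) <-> (a + star b = - b + star b + c%:MP).
Proof.
split=> [|].
  rewrite -addrA => /addrI E.
  have -> : b = - a + c%:MP by rewrite -[b]starK E raddfD raddfN /= starK starC.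
  rewrite raddfD raddfN /= starC opprD opprK.
  by apply: mcoeff_inj => s; rewrite !(mcoeffD, mcoeffN); ring.
rewrite addrAC => /addIr ->; rewrite raddfD raddfN /= starC.
by apply: mcoeff_inj => s; rewrite !(mcoeffD, mcoeffN); ring.
Qed.

End Polynomials.

Theorem theorem1p5 (R : realType) (g : nat) (p : ncpoly R g) (hp : p <> 0) :
  [/\ (* (1) *)
      homogeneous p ->
      (real_ideal (lideal_gen p) <->
       ~ (exists s q f : ncpoly R g,
            [/\ sum_of_squares s, ~ constant_poly s, star q = - q
              & p = (s + q) * f])),
      (* (2) *)
      (exists s q f : ncpoly R g,
         [/\ sum_of_squares s, ~ constant_poly s, star q = - q
           & p = (s + q) * f]) ->
      ~ real_ideal (lideal_gen p)
    & (* (3) *)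
      forall a b : ncpoly R g,
        analytic a -> analytic b -> ~ constant_poly p -> p = a + star b ->
        (~ real_ideal (lideal_gen p) <->
         exists c : R, c <> 0 /\ p = a - star a + c%:MP) /\
        (forall c : R, c <> 0 ->
           (p = a - star a + c%:MP <-> p = - b + star b + c%:MP))].
Proof.
split.
- move=> ph; split=> [pR pS|]; last exact: homogeneous_real.
  exact: (skew_multiple_not_real hp pS).
- exact: skew_multiple_not_real.
- move=> a b aa ab pN pE; split.
    split; first exact: (analytic_shift_of_not_real aa ab pN pE).
    by move=> [c [c0 pc]]; exact: (analytic_shift_not_real pN c0 pc).
  by move=> c _; rewrite pE; exact: analytic_shift_swap.
Qed.
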